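(* Let $R$ be a semiprimitive commutative ring with identity. The following statements are equivalent. (a) For each $x\in R$, $h_M(x)\neq\emptyset$ implies $h_M(x)^\circ\neq\emptyset$. (b) Every regular element of $R$ is a unit. (c) $R$ has no regular proper ideal.
   Context: $\mathrm{Max}(R)$ is the set of maximal ideals of $R$; for $S\subseteq R$, $h_M(S)=\{M\in\mathrm{Max}(R): S\subseteq M\}$, and $h_M(x)=h_M(\{x\})$. $\mathrm{Max}(R)$ carries the Zariski topology, whose closed sets are the sets $h_M(S)$; $A^\circ$ denotes the interior of $A\subseteq\mathrm{Max}(R)$. $R$ is semiprimitive if the intersection of all its maximal ideals is $\{0\}$. An element of $R$ is regular if it is not a zero-divisor; an ideal is regular if it contains a regular element. *)

(* Defs.v *)
From HB Require Import structures.
From mathcomp Require Import all_boot all_order all_algebra.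
From mathcomp Require Import all_classical topology.

Set Implicit Arguments.
Unset Strict Implicit.
Unset Printing Implicit Defensive.

Import GRing.Theory.
Local Open Scope classical_set_scope.
Local Open Scope ring_scope.

(* [comPzRingType] is used throughout so that the zero ring is not excluded. *)

Section Elements.
Variable R : comPzRingType.

(* In the zero ring this makes 0 regular, and 0 is also a unit there. *)
Definition zero_divisor (x : R) : Prop := exists2 y : R, y <> 0 & x * y = 0.

Definition regular (x : R) : Prop := ~ zero_divisor x.

(* [GRing.unit] is only available for nontrivial rings equipped with a
   decidable notion of unit. *)
Definition is_unit (x : R) : Prop := exists y : R, x * y = 1.

End Elements.

Section Ideals.
Variable R : comPzRingType.

(* An ideal is a submodule of the regular module [R^o]; unlike
   [idealr_closed], this allows the whole ring. *)
Definition ideal (I : set R) : Prop :=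
  GRing.submod_closed ([in I] : {pred R^o}).

Lemma idealP (I : set R) :
  ideal I <-> [/\ I 0, forall x y, I x -> I y -> I (x + y)
                & forall a x, I x -> I (a * x)].
Proof.
split=> [[/set_mem I0 IZD]|[I0 ID IM]].
  have IZ a x : I x -> I (a * x).
    by move=> Ix; have /set_mem := IZD a x 0 (mem_set Ix) (mem_set I0);
       rewrite addr0.
  split=> // x y Ix Iy.
  by have /set_mem := IZD 1 x y (mem_set Ix) (mem_set Iy); rewrite scale1r.
by split=> [|a x y /set_mem Ix /set_mem Iy]; apply: mem_set => //;
   apply: ID => //; apply: IM.
Qed.

Definition regular_ideal (I : set R) : Prop := exists2 x, I x & regular x.

Definition maximal_ideal (M : set R) : Prop :=
  [/\ ideal M, M <> [set: R] &
      forall J : set R, ideal J -> M `<=` J -> J = M \/ J = [set: R]].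

End Ideals.

Record Max (R : comPzRingType) := MaxIdeal {
  Max_set :> set R;
  Max_maximal : maximal_ideal Max_set
}.

HB.instance Definition _ (R : comPzRingType) := gen_eqMixin (Max R).
HB.instance Definition _ (R : comPzRingType) := gen_choiceMixin (Max R).

Definition h_M (R : comPzRingType) (S : set R) : set (Max R) :=
  [set M : Max R | S `<=` M].

Definition semiprimitive (R : comPzRingType) : Prop :=
  \bigcap_(M in [set: Max R]) (M : set R) = [set 0].

Section Zariski.
Variable R : comPzRingType.

Lemma Max_proper (M : Max R) : ~ (M : set R) 1.
Proof.
case: M => M [/= /idealP[_ _ MM] Mp _] M1; apply: Mp.
by apply/seteqP; split=> // x _; rewrite -[x]mulr1; apply: MM.
Qed.

Lemma Max_prime (M : Max R) (x y : R) :
  (M : set R) (x * y) -> (M : set R) x \/ (M : set R) y.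
Proof.
case: M => M [/= /idealP[M0 MD MM] Mp Mmax] Mxy.
have [Mx|nMx] := pselect (M x); [by left|right].
pose J : set R := [set z | exists m a, M m /\ z = m + a * x].
have J_ideal : ideal J.
  apply/idealP; split.
  - by exists 0, 0; rewrite mul0r addr0.
  - move=> _ _ [m [a [Mm ->]]] [n [b [Mn ->]]]; exists (m + n), (a + b).
    by split; [exact: MD|rewrite mulrDl addrACA].
  - move=> c _ [m [a [Mm ->]]]; exists (c * m), (c * a).
    by split; [exact: MM|rewrite mulrDr mulrA].
have MJ : M `<=` J by move=> m Mm; exists m, 0; rewrite mul0r addr0.
have Jx : J x by exists 0, 1; rewrite mul1r add0r.
have [JM|JT] := Mmax J J_ideal MJ; first by rewrite JM in Jx.
have : J 1 by rewrite JT.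
case=> m [a [Mm e]]; rewrite -[y]mul1r e mulrDl -mulrA.
by apply: MD; [rewrite mulrC|]; apply: MM.
Qed.

Definition Zariski_open : set_system (Max R) :=
  [set U | exists S : set R, ~` U = h_M S].

Lemma Zariski_openT : Zariski_open setT.
Proof.
exists setT; rewrite setCT; apply/seteqP; split=> // M hM.
by exfalso; apply: (@Max_proper M); apply: hM.
Qed.

Lemma Zariski_openI : setI_closed Zariski_open.
Proof.
move=> U V [S US] [T VT]; exists [set x * y | x in S & y in T].
rewrite setCI US VT; apply/seteqP; split=> [M hM _ [x Sx [y Ty <-]]|M hM].
  have /idealP[_ _ MM] : ideal M by case: (Max_maximal M).
  by case: hM => hM; [rewrite mulrC|]; apply: MM; apply: hM.
have [SM|/existsNP[x /not_implyP[Sx nMx]]] := pselect (S `<=` M); first by left.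
right=> y Ty; have Mxy : (M : set R) (x * y).
  by apply: hM; exists x => //; exists y.
by have [] := Max_prime Mxy.
Qed.

Lemma Zariski_open_bigU (I : Type) (f : I -> set (Max R)) :
  (forall i, Zariski_open (f i)) -> Zariski_open (\bigcup_i f i).
Proof.
move=> /choice[S fS]; exists (\bigcup_i S i).
rewrite setC_bigcup; apply/seteqP; split=> [M hM x [i _ Six]|M hM i _].
  by have : h_M (S i) M; [rewrite -fS; apply: hM|apply].
by rewrite fS => x Six; apply: hM; exists i.
Qed.

End Zariski.

HB.instance Definition _ (R : comPzRingType) :=
  isOpenTopological.Build (Max R)
    (@Zariski_openT R) (@Zariski_openI R) (@Zariski_open_bigU R).

Lemma Zariski_closedP (R : comPzRingType) (A : set (Max R)) :
  closed A <-> exists S : set R, A = h_M S.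
Proof.
by rewrite -openC; split=> -[S AS]; exists S; move: AS; rewrite setCK.
Qed.

(* Main.v *)
Require Import Defs.
From HB Require Import structures.
From mathcomp Require Import all_boot all_order all_algebra.
From mathcomp Require Import all_classical topology.

Import GRing.Theory.

Local Open Scope classical_set_scope.
Local Open Scope ring_scope.

(** The bridge between algebra and topology is that, in a semiprimitive ring,
    [x] is a zero-divisor exactly when [h_M(x)] has nonempty interior
    ([zero_divisorP]).  The complement of [h_M(y)] is open, and it lies inside
    [h_M(x)] as soon as [x * y = 0], because maximal ideals are prime; it is
    nonempty when [y <> 0], because no nonzero element lies in every maximal
    ideal.  Conversely a basic open neighbourhood of a point, contained in
    [h_M(x)], is the complement of some [h_M(y)] with [y <> 0]; then every
    maximal ideal contains [x] or [y], so [x * y = 0].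

    On the other hand [h_M(x)] is nonempty exactly when [x] is not a unit,
    since every proper ideal lies in a maximal one ([proper_ideal_sub_max],
    by Zorn's lemma).  Condition (a) thus says that non-units are
    zero-divisors, which is the contrapositive of (b).  Finally (b)
    implies (c) because a proper ideal contains no unit, and (c) implies (a)
    because the points of [h_M(x)] are themselves proper ideals containing
    [x], which forces [x] to be a zero-divisor when there is one. *)

Lemma ideal_eqT (R : comPzRingType) (I : set R) :
  ideal I -> I 1 -> I = [set: R].
Proof.
move=> /idealP[_ _ IM] I1; apply/seteqP; split=> // x _.
by rewrite -[x]mulr1; apply: IM.
Qed.

Lemma ideal_principal (R : comPzRingType) (x : R) :
  ideal [set x * y | y in [set: R]].
Proof.
apply/idealP; split.
- by exists 0 => //; rewrite mulr0.
- by move=> _ _ [a _ <-] [b _ <-]; exists (a + b) => //; rewrite mulrDr.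
- by move=> c _ [a _ <-]; exists (c * a) => //; rewrite mulrCA.
Qed.

(** Properness is expressed as [~ J 1] rather than [J <> setT], which makes it
    stable under unions of chains. *)
Lemma proper_ideal_sub_max (R : comPzRingType) (I : set R) :
  ideal I -> ~ I 1 -> exists M : Max R, I `<=` M.
Proof.
move=> idI nI1.
(* The union of the empty chain is [set0], so the family to which Zorn's lemma
   is applied has to contain [set0] besides the proper ideals above [I]. *)
pose P : set (set R) :=
  [set J | J !=set0 -> [/\ ideal J, I `<=` J & ~ J 1]].
have [F FP Ftot|A [PA Amax]] := @Zorn_bigcup R P.
  move=> [z [X0 FX0 X0z]].
  have [idX0 IX0 _] := FP X0 FX0 (ex_intro _ z X0z).
  have idF X x : F X -> X x -> ideal X.
    by move=> FX Xx; case: (FP X FX (ex_intro _ x Xx)).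
  split.
  - apply/idealP; split.
    + by exists X0 => //; case/idealP: idX0.
    + move=> x y [X FX Xx] [Y FY Yy].
      have [XY|YX] := Ftot _ _ FX FY.
        exists Y => //; have /idealP[_ YD _] := idF _ _ FY Yy.
        by apply: YD => //; apply: XY.
      exists X => //; have /idealP[_ XD _] := idF _ _ FX Xx.
      by apply: XD => //; apply: YX.
    + move=> a x [X FX Xx]; exists X => //.
      by have /idealP[_ _ XM] := idF _ _ FX Xx; apply: XM.
  - by move=> x Ix; exists X0 => //; apply: IX0.
  - by move=> [X FX X1]; case: (FP X FX (ex_intro _ 1 X1)).
have I0 : I 0 by case/idealP: idI.
have [idA IA nA1] : [/\ ideal A, I `<=` A & ~ A 1].
  apply: PA; apply: contrapT => A0; apply: (Amax I); last by move=> _; split.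
  split=> [x Ax|IA]; first by case: A0; exists x.
  by apply: A0; exists 0; apply: IA.
have maxA : maximal_ideal A.
  split=> // [AT|J idJ AJ]; first by apply: nA1; rewrite AT.
  have [J1|nJ1] := pselect (J 1); first by right; apply: ideal_eqT.
  left; apply/seteqP; split=> //; apply: contrapT => nJA.
  apply: (Amax J); first by split.
  by move=> _; split=> //; apply: subset_trans AJ.
by exists (MaxIdeal maxA).
Qed.

Lemma not_unit_h_M (R : comPzRingType) (x : R) :
  ~ is_unit x -> h_M [set x] !=set0.
Proof.
move=> nux; have [[y _ xy1]|M xM] :=
  @proper_ideal_sub_max R _ (ideal_principal R x); first by apply: nux; exists y.
by exists M => _ ->; apply: xM; exists 1; rewrite ?mulr1.
Qed.

Lemma semiprimitive_eq0 (R : comPzRingType) (x : R) :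
  semiprimitive R -> (forall M : Max R, (M : set R) x) -> x = 0.
Proof.
move=> hR xM.
suff : (\bigcap_(M in [set: Max R]) (M : set R)) x by rewrite hR.
by move=> M _; apply: xM.
Qed.

(** If [x * y = 0], the complement of [h_M(y)] is an open subset of [h_M(x)].
    In the other direction, the complement of the interior is some [h_M(S)],
    and a point of the interior misses some [y] in [S]: this [y] is the
    cofactor, as it lies in every maximal ideal outside the interior. *)
Lemma zero_divisorP (R : comPzRingType) (x : R) :
  semiprimitive R -> zero_divisor x <-> (h_M [set x])° !=set0.
Proof.
move=> hR; split=> [[y y0 xy0]|[M Mint]].
  have [M nMy] : exists M : Max R, ~ (M : set R) y.
    by apply/existsNP => yM; apply: y0; apply: semiprimitive_eq0.
  exists M.
  have oU : open (~` h_M [set y]).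
    by rewrite openC; apply/Zariski_closedP; exists [set y].
  move: M nMy; have : ~` h_M [set y] `<=` (h_M [set x])°.
    rewrite -open_subsetE// => N nNy _ ->.
    have N0 : (N : set R) 0 by case: (Max_maximal N) => /idealP[].
    have : (N : set R) (x * y) by rewrite xy0.
    by case/Max_prime => // Ny; case: nNy => _ ->.
  by move=> sub M nMy; apply: sub => yM; apply: nMy; apply: yM.
have /Zariski_closedP[S intS] : closed (~` (h_M [set x])°).
  by rewrite -openC setCK; apply: open_interior.
have /existsNP[y /not_implyP[Sy nMy]] : ~ h_M S M by rewrite -intS; apply.
exists y.
  by move=> y0; apply: nMy; rewrite y0; case: (Max_maximal M) => /idealP[].
apply: semiprimitive_eq0 => // N.
have /idealP[_ _ NM] : ideal N by case: (Max_maximal N).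
have [Nint|nNint] := pselect ((h_M [set x])° N).
  by rewrite mulrC; apply: NM; apply: (interior_subset Nint).
have hN : h_M S N by rewrite -intS.
by apply: NM; apply: hN.
Qed.

Theorem corollary4p20 (R : comPzRingType) (hR : semiprimitive R) :
  [<-> (* a *) forall x : R, h_M [set x] <> set0 -> (h_M [set x])° <> set0;
       (* b *) forall x : R, regular x -> is_unit x;
       (* c *) ~ exists I : set R,
                 [/\ ideal I, I <> [set: R] & regular_ideal I]].
Proof.
tfae.
- move=> a x regx; apply: contrapT => /not_unit_h_M /set0P/eqP/a/eqP/set0P.
  by move/(zero_divisorP _ _ hR).
- move=> b [I [idI IT [x Ix /b[y xy1]]]]; apply: IT; apply: ideal_eqT => //.
  by rewrite -xy1 mulrC; case/idealP: idI => _ _; apply.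
- move=> c x /eqP/set0P[M xM]; apply/eqP/set0P/(zero_divisorP _ _ hR).
  apply: contrapT => regx; apply: c; exists M.
  have [idM MT _] := Max_maximal M.
  by split=> //; exists x => //; apply: xM.
Qed.
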